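(* Let $\Theta\subset[0,1]$ be countable with complexity function $K_w:\Theta\to[0,\infty)$, and let $\theta_0\in\Theta$ be the true parameter. For every integer $n\ge3$, the expected instantaneous square loss of the MDL estimator satisfies $$\mathbf{E}\big(\theta_0-\theta^{x_{1:n}}\big)^2\;\le\;\frac{(\ln2)K_w(\theta_0)}{2n}+\frac{\sqrt{2(\ln2)K_w(\theta_0)\ln n}}{n}+\frac{6\ln n}{n}.$$
   Context: Each $\theta\in\Theta$ has weight $w_\theta=2^{-K_w(\theta)}\le1$ (weights are not required to sum to at most one). For $x\in\{0,1\}^n$, $n\ge1$, let $\mathbf 1(x)$ be its number of ones and $P(x|\theta)=\theta^{\mathbf 1(x)}(1-\theta)^{n-\mathbf 1(x)}$ (with $0^0=1$). The MDL estimator $\theta^x=\arg\max_{\theta\in\Theta}\{w_\theta P(x|\theta)\}$ is an element of $\Theta$ attaining the maximum (a maximizer is presupposed to exist; ties are broken by any fixed rule depending only on $n$ and $\mathbf 1(x)/n$). $\mathbf{E}$ is expectation when $x_{1:n}=x_1\dots x_n$ consists of i.i.d. bits with $P(x_i=1)=\theta_0$. *)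

(* Defs.v *)
From HB Require Import structures.
From mathcomp Require Export all_boot all_order all_algebra.
From mathcomp Require Export all_classical all_reals all_analysis.

Set Implicit Arguments.
Unset Strict Implicit.
Unset Printing Implicit Defensive.

Import Order.TTheory GRing.Theory Num.Theory.
Local Open Scope classical_set_scope.
Local Open Scope ring_scope.

Section mdl.
Context {R : realType}.

(* The complexity is a total function on R; only its values on the parameter
   set are ever constrained or used. *)
Definition weight (Kw : R -> R) (theta : R) : R := 2 `^ (- Kw theta).

Definition ones n (x : n.-tuple bool) : nat := count id x.

(* [^+ 0] is 1 also in base 0, which gives the convention 0^0 = 1. *)
Definition likelihood n (x : n.-tuple bool) (theta : R) : R :=
  theta ^+ ones x * (1 - theta) ^+ (n - ones x).

Definition is_argmax (A : set R) (f : R -> R) (t : R) : Prop :=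
  A t /\ forall s, A s -> f s <= f t.

(* At a fixed sample length n, a tie-breaking rule depending only on n and on
   the frequency of ones is one depending only on the number of ones. *)
Definition mdl_estimator n (Theta : set R) (Kw : R -> R)
    (est : n.-tuple bool -> R) : Prop :=
  (forall x, is_argmax Theta (fun t => weight Kw t * likelihood x t) (est x)) /\
  (forall x y, ones x = ones y -> est x = est y).

End mdl.

Section iid.
Context {d : measure_display} {T : measurableType d} {R : realType}.
Variable P : probability T R.

Definition mutually_independent (I : finType) d' (T' : measurableType d')
    (X : I -> {RV P >-> T'}) : Prop :=
  forall (J : {set I}) (B : I -> set T'), (forall i, measurable (B i)) ->
    P (\bigcap_(i in [set` J]) (X i @^-1` B i)) =
    (\prod_(i in J) P (X i @^-1` B i))%E.

Definition iid_bits n (theta : R) (X : 'I_n -> {RV P >-> bool}) : Prop :=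
  mutually_independent X /\
  forall i, P (X i @^-1` [set true]) = theta%:E.

End iid.

(* Main.v *)
Require Import Defs.
From mathcomp Require Import measurable_realfun ring lra.

Set Implicit Arguments.
Unset Strict Implicit.
Unset Printing Implicit Defensive.

Import Order.TTheory GRing.Theory Num.Theory.
Import numFieldNormedType.Exports.
Local Open Scope classical_set_scope.
Local Open Scope ring_scope.

(** The error of the estimator splits through the observed frequency a of ones:
theta0 - theta^x = (a - theta^x) - (a - theta0).

The second difference is the ordinary sampling error, of mean square
theta0 (1 - theta0) / n.  For the first, write D(a||t) for the Kullback-Leibler
divergence between coins of biases a and t.  Up to a term depending on the
sample only, the log-likelihood of t is - n D(a||t), so that maximality of
theta^x against theta0, with nonnegative complexities, says
  n D(a||theta^x) <= n D(a||theta0) + (ln 2) Kw(theta0).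
Pinsker's inequality ([pinsker]) bounds the left side below by
2 n (a - theta^x)^2, and comparison with the chi-square divergence
([kl_le_chi2]) bounds D(a||theta0) by (a - theta0)^2 / (theta0 (1 - theta0)).
Together this is [argmax_sqdist]: the distance from the frequency to the
estimator is controlled by the complexity term and by the sampling error alone.
For every theta0 strictly between 0 and 1 the chi-square term has expectation
exactly 1 / n, because its denominator is the variance of one bit.

Young's inequality (u - v)^2 <= (1 + 1/l) u^2 + (1 + l) v^2 then makes the loss
at most a constant plus a multiple of the squared deviation of the number of
ones from its mean ([sqloss_le_sqdev]), and the variance of a sum of pairwise
independent events integrates this ([expectation_le_sqdev]).  The choice
l = 1 + sqrt (2 (ln 2) Kw(theta0)) balances the two parts and keeps the
leading constant 1/2 of the complexity; what remains is of order
(1 + sqrt Kw(theta0)) / n, and is absorbed by the logarithms since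
ln n >= 2/3 for n >= 3 ([mdl_bound_arith]). *)

(** * Divergence between coins *)

Section kl.
Context {R : realType}.
Implicit Types a t : R.

(** With [ln 0 = 0] this formula is the divergence D(a||t) whenever that is
finite, which is what [dominated] expresses; when it is infinite the formula
has a meaningless finite value. *)
Definition kl a t : R :=
  a * (ln a - ln t) + (1 - a) * (ln (1 - a) - ln (1 - t)).

(** Absolute continuity of the coin of bias a with respect to the coin of
bias t. *)
Definition dominated a t := (t = 0 -> a = 0) /\ (t = 1 -> a = 1).

(** Exchanging the two faces of the coins reduces [pinsker] to [a <= t]. *)
Lemma kl_flip a t : kl (1 - a) (1 - t) = kl a t.
Proof. by rewrite /kl !subKr addrC. Qed.

Lemma kl_refl a : kl a a = 0.
Proof. by rewrite /kl !subrr !mulr0 addr0. Qed.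

(** As a function of s, the derivative of
2 (a - s)^2 - D(a||s) is - (s - a) (1 - 2 s)^2 / (s (1 - s)), which is
nonpositive to the right of a, and the difference vanishes at s = a. *)
Lemma pinsker_right a t : 0 <= a <= t -> t < 1 -> 2 * (a - t) ^+ 2 <= kl a t.
Proof.
move=> /andP[a0 at_] t1.
(* The cross entropy part of - D(a||s), plus the square: the part of the
   difference that varies with s. *)
pose f (s : R) : R := a * ln s + ((1 - a) * ln (1 - s) + 2 * (s - a) ^+ 2).
pose df (s : R) : R := a * s^-1 + ((1 - a) * - (1 - s)^-1 + 2 * (2 * (s - a))).
have dsmooth (s : R) : s < 1 -> is_derive s 1
    (fun u : R => (1 - a) * ln (1 - u) + 2 * (u - a) ^+ 2 : R)
    ((1 - a) * - (1 - s)^-1 + 2 * (2 * (s - a))).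
  move=> s1; have s1' : 0 < 1 - s by rewrite subr_gt0.
  have dln : is_derive s 1 (fun u : R => ln (1 - u) : R) (- (1 - s)^-1).
    have d1B : is_derive s 1 (fun u : R => 1 - u : R) (-1).
      by apply: is_derive_eq; rewrite add0r mul1r.
    rewrite -[X in is_derive _ _ _ X]mulrN1.
    exact: (is_derive1_comp (g := fun u : R => 1 - u) (is_derive1_ln s1')).
  apply: is_deriveD.
  by apply: is_derive_eq; rewrite /GRing.scale /=; ring.
have dfE (s : R) : 0 < s < 1 -> is_derive s 1 f (df s).
  move=> /andP[s0 s1]; have := is_derive1_ln s0 => ?.
  by have := dsmooth s s1 => ?; apply: is_deriveD.
have cf : {within `[a, t], continuous f}.
  (* When a = 0 the interval reaches the singularity of ln, but there the
     coefficient of ln s vanishes. *)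
  have [a_eq0|an0] := eqVneq a 0.
    rewrite (_ : f = fun u : R => (1 - a) * ln (1 - u) + 2 * (u - a) ^+ 2 : R);
      last by apply/funext => u; rewrite /f {1}a_eq0 mul0r add0r.
    apply: continuous_in_subspaceT => s.
    rewrite inE /= in_itv /= => /andP[_ st].
    have [+ _] := dsmooth s (le_lt_trans st t1).
    by move=> /derivable1_diffP/differentiable_continuous.
  apply: continuous_in_subspaceT => s.
  rewrite inE /= in_itv /= => /andP[as_ st].
  have s01 : 0 < s < 1.
    rewrite (le_lt_trans st t1) andbT (lt_le_trans _ as_)//.
    by rewrite lt_neqAle eq_sym an0.
  have [+ _] := dfE s s01.
  by move=> /derivable1_diffP/differentiable_continuous.
have dfoo (s : R) : s \in `]a, t[ -> is_derive s 1 f (df s).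
  rewrite in_itv /= => /andP[as_ st]; apply: dfE.
  by rewrite (le_lt_trans a0 as_) (lt_trans st t1).
have [c] := MVT_segment at_ dfoo cf.
rewrite in_itv /= => /andP[ac ct] fE.
have c1 : 0 < 1 - c by lra.
suff dfc : df c <= 0.
  have : f t - f a <= 0 by rewrite fE mulr_le0_ge0// subr_ge0.
  rewrite /f /kl; nra.
(* The mean value point may be the endpoint 0 = a, where df is not the
   derivative but still has the right sign. *)
have [c_eq0|cn0] := eqVneq c 0.
  have -> : df c = -1 by rewrite /df c_eq0 invr0 subr0 invr1; lra.
  by [].
have c0 : 0 < c by rewrite lt_neqAle eq_sym cn0/= (le_trans a0).
have -> : df c = - ((c - a) * (1 - 2 * c) ^+ 2 / (c * (1 - c))).
  by rewrite /df; field; rewrite cn0 gt_eqF.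
have cc : 0 <= c * (1 - c) by rewrite mulr_ge0// ltW.
by rewrite oppr_le0 divr_ge0// mulr_ge0 ?sqr_ge0 ?subr_ge0.
Qed.

Lemma pinsker a t : 0 <= a <= 1 -> 0 <= t <= 1 -> dominated a t ->
  2 * (a - t) ^+ 2 <= kl a t.
Proof.
move=> /andP[a0 a1] /andP[t0 t1] [at0 at1].
have [t_eq0|tn0] := eqVneq t 0.
  by rewrite t_eq0 (at0 t_eq0) kl_refl subrr expr0n mulr0.
have [t_eq1|tn1] := eqVneq t 1.
  by rewrite t_eq1 (at1 t_eq1) kl_refl subrr expr0n mulr0.
have tgt0 : 0 < t by rewrite lt_neqAle eq_sym tn0.
have tlt1 : t < 1 by rewrite lt_neqAle tn1.
have [le_at|lt_ta] := leP a t; first by apply: pinsker_right; rewrite ?a0.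
rewrite -kl_flip (_ : a - t = - (1 - a - (1 - t))); last by ring.
by rewrite sqrrN; apply: pinsker_right; lra.
Qed.

(** [ln u <= u - 1] at u = a / t; summed over both faces of the coin it turns
the divergence into the chi-square divergence. *)
Lemma ln_ratio_le a t : 0 <= a -> 0 < t -> a * (ln a - ln t) <= a * (a / t - 1).
Proof.
rewrite le_eqVlt => /predU1P[<-|a0] t0; first by rewrite !mul0r.
rewrite ler_pM2l// -ln_div ?posrE//.
have at0 : 0 < a / t by rewrite divr_gt0.
by rewrite -{1}[a / t](subrKC 1) le_ln1Dx// ltrBrDl addrN.
Qed.

Lemma kl_le_chi2 a t : 0 <= a <= 1 -> 0 <= t <= 1 -> dominated a t ->
  kl a t <= (a - t) ^+ 2 / (t * (1 - t)).
Proof.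
move=> /andP[a0 a1] /andP[t0 t1] [at0 at1].
have [t_eq0|tn0] := eqVneq t 0.
  by rewrite t_eq0 (at0 t_eq0) kl_refl mul0r invr0 mulr0.
have [t_eq1|tn1] := eqVneq t 1.
  by rewrite t_eq1 (at1 t_eq1) kl_refl subrr mulr0 invr0 mulr0.
have tgt0 : 0 < t by rewrite lt_neqAle eq_sym tn0.
have tlt1 : 0 < 1 - t by rewrite subr_gt0 lt_neqAle tn1.
have -> : (a - t) ^+ 2 / (t * (1 - t)) =
    a * (a / t - 1) + (1 - a) * ((1 - a) / (1 - t) - 1).
  by field; rewrite tn0 gt_eqF.
by apply: lerD; apply: ln_ratio_le; rewrite ?subr_ge0.
Qed.

End kl.

(** * Maximizers of the weighted likelihood *)

Section argmax.
Context {R : realType}.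
Implicit Types s t : R.

Definition freq n (x : n.-tuple bool) : R := (ones x)%:R / n%:R.

Lemma ones_le n (x : n.-tuple bool) : (ones x <= n)%N.
Proof. by rewrite -[leqRHS](size_tuple x) count_size. Qed.

Lemma freq_itv n (x : n.-tuple bool) : (0 < n)%N -> 0 <= freq x <= 1.
Proof.
move=> n0; rewrite /freq divr_ge0 ?ler0n//= ler_pdivrMr ?ltr0n//.
by rewrite mul1r ler_nat ones_le.
Qed.

(** Positivity of the likelihood is the same as finiteness of the divergence:
a maximizer inherits both from any competitor that explains the sample. *)
Lemma likelihood_gt0 n (x : n.-tuple bool) t : (0 < n)%N -> 0 <= t <= 1 ->
  0 < likelihood x t <-> dominated (freq x) t.
Proof.
move=> n0 /andP[t0 t1]; have nR0 : n%:R != 0 :> R by rewrite pnatr_eq0 -lt0n.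
have kn := ones_le x.
have t1' : 0 <= 1 - t by rewrite subr_ge0.
rewrite lt0r mulr_ge0 ?exprn_ge0// andbT mulf_eq0 !expf_eq0 subn_gt0.
split=> [|[at0 at1]].
  rewrite negb_or !negb_and -!leqNgt leqn0 => /andP[k0 k1]; split=> tE.
    by move: k0; rewrite tE eqxx orbF /freq => /eqP ->; rewrite mul0r.
  move: k1; rewrite tE subrr eqxx orbF => nk.
  by rewrite /freq (@anti_leq (ones x) n) ?kn// divff.
apply/negP => /orP[|] /andP[k0 /eqP tE].
  move: (at0 tE) => /eqP; rewrite /freq mulf_eq0 invr_eq0 (negPf nR0) orbF.
  by rewrite pnatr_eq0 => /eqP kE; rewrite kE in k0.
have /at1 : t = 1 by lra.
move=> /eqP; rewrite /freq -(inj_eq (mulIf nR0)) mulfVK// mul1r eqr_nat.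
move=> /eqP kE; by rewrite kE ltnn in k0.
Qed.

Lemma ln_likelihood n (x : n.-tuple bool) t : (0 < n)%N -> 0 <= t <= 1 ->
  dominated (freq x) t ->
  ln (likelihood x t) = n%:R * (freq x * ln t + (1 - freq x) * ln (1 - t)).
Proof.
move=> n0 t01 dom; have nR0 : n%:R != 0 :> R by rewrite pnatr_eq0 -lt0n.
have nfreq : n%:R * freq x = (ones x)%:R by rewrite /freq mulrC mulfVK.
have lnX k s : 0 <= s -> 0 < s ^+ k -> ln (s ^+ k) = k%:R * ln s.
  case: k => [|k] s0 sk; first by rewrite expr0 ln1 mul0r.
  rewrite lnXn ?mulr_natl// lt0r s0 andbT.
  by apply: contraTneq sk => ->; rewrite expr0n ltxx.
have /andP[t0 t1] := t01.
have t1' : 0 <= 1 - t by rewrite subr_ge0.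
have := (likelihood_gt0 x n0 t01).2 dom; rewrite /likelihood => lik0.
have [Xt Xt'] : 0 < t ^+ ones x /\ 0 < (1 - t) ^+ (n - ones x).
  by split; rewrite lt0r exprn_ge0 ?andbT//; apply: contraTN lik0 => /eqP ->;
    rewrite ?mul0r ?mulr0 ltxx.
rewrite lnM ?posrE// !lnX// natrB ?ones_le// -nfreq.
by ring.
Qed.

(** Comparing the maximizer s with the competitor t, the weight of s only
helps, and the entropy of the sample cancels from the log-likelihoods, leaving
D(a||s) <= D(a||t) + (ln 2) (Kw t) / n with a the frequency.  Pinsker's
inequality and the chi-square bound turn both divergences into squares.  The
denominator t (1 - t) may be 0, but then domination forces a = t. *)
Lemma argmax_sqdist n (x : n.-tuple bool) (Theta : set R) (Kw : R -> R) s t :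
  (0 < n)%N -> Theta `<=` [set u | 0 <= u <= 1] -> 0 <= Kw s ->
  is_argmax Theta (fun u => weight Kw u * likelihood x u) s ->
  Theta t -> dominated (freq x) t ->
  2 * (freq x - s) ^+ 2 <=
    ln 2 * Kw t / n%:R + (freq x - t) ^+ 2 / (t * (1 - t)).
Proof.
move=> n0 Theta01 Ks [Ts smax] Tt domt.
have nR0 : 0 < n%:R :> R by rewrite ltr0n.
have [s01 t01] := (Theta01 _ Ts, Theta01 _ Tt).
have w0 u : 0 < weight Kw u by rewrite powR_gt0.
have Lt : 0 < likelihood x t by apply/likelihood_gt0.
have Ls : 0 < likelihood x s.
  by rewrite -(pmulr_rgt0 _ (w0 s)) (lt_le_trans _ (smax t Tt))// mulr_gt0.
have doms : dominated (freq x) s by apply/likelihood_gt0.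
have wL_gt0 u : 0 < likelihood x u -> 0 < weight Kw u * likelihood x u.
  by move=> ?; rewrite mulr_gt0.
have /= := smax t Tt; rewrite -ler_ln ?posrE ?wL_gt0//.
rewrite (lnM (w0 t) Lt) (lnM (w0 s) Ls) !ln_likelihood// !ln_powR => lnle.
have ln20 : 0 <= ln 2 :> R by rewrite ln_ge0// ler1n.
have Ks' : 0 <= ln 2 * Kw s by rewrite mulr_ge0.
have {}lnle : n%:R * (kl (freq x) s - kl (freq x) t) <= ln 2 * Kw t.
  by rewrite /kl; nra.
have f01 := freq_itv x n0.
apply: (le_trans (pinsker f01 s01 doms)).
rewrite -lerBlDr (le_trans (lerB (lexx _) (kl_le_chi2 f01 t01 domt)))//.
by rewrite ler_pdivlMr// mulrC.
Qed.

End argmax.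

(** * Variance of the number of events *)

Section count_events.
Context {d : measure_display} {T : measurableType d} {R : realType}.
Variable P : probability T R.
Variables (n : nat) (A : 'I_n -> set T) (p : R).
Hypothesis mA : forall i, measurable (A i).
Hypothesis PA : forall i, P (A i) = p%:E.
Hypothesis PAI : forall i j, i != j -> P (A i `&` A j) = (p ^+ 2)%:E.

Definition nb_events (w : T) : R := \sum_(i < n) \1_(A i) w.

Lemma measurable_nb_events : measurable_fun setT nb_events.
Proof. by apply: measurable_sum => i; exact: measurable_indic. Qed.

Lemma nb_events_ge0 w : 0 <= nb_events w.
Proof. by apply: sumr_ge0 => i _. Qed.

Let integral_event B : measurable B -> (\int[P]_w (\1_B w)%:E = P B)%E.
Proof. by move=> mB; rewrite integral_indic// setIT. Qed.

Lemma integral_nb_events : (\int[P]_w (nb_events w)%:E = (n%:R * p)%:E)%E.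
Proof.
under eq_integral do rewrite -sumEFin.
rewrite ge0_integral_sum//; last first.
  by move=> i; apply/measurable_EFinP; exact: measurable_indic.
under eq_bigr do rewrite integral_event// PA.
by rewrite sumEFin sumr_const card_ord mulr_natl.
Qed.

(** The square of a sum of indicators is the sum of the indicators of the
pairwise intersections; the n diagonal ones have probability p, the others
p ^+ 2. *)
Lemma integral_nb_events2 :
  (\int[P]_w (nb_events w ^+ 2)%:E
   = (n%:R * p * (1 - p) + (n%:R * p) ^+ 2)%:E)%E.
Proof.
have sqE w : nb_events w ^+ 2 = \sum_(i < n) \sum_(j < n) \1_(A i `&` A j) w.
  rewrite expr2 mulr_suml; apply: eq_bigr => i _.
  by rewrite mulr_sumr; apply: eq_bigr => j _; rewrite indicI.
under eq_integral do rewrite sqE -sumEFin.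
rewrite ge0_integral_sum//; last 2 first.
- move=> i; apply/measurable_EFinP; apply: measurable_sum => j.
  by apply: measurable_indic; exact: measurableI.
- by move=> i w _; rewrite lee_fin sumr_ge0.
rewrite (eq_bigr (fun=> (p + (n%:R - 1) * p ^+ 2)%:E)); last first.
  move=> i _; under eq_integral do rewrite -sumEFin.
  rewrite ge0_integral_sum//; last first.
    move=> j; apply/measurable_EFinP; apply: measurable_indic.
    exact: measurableI.
  rewrite (bigD1 i)//= (eq_bigr (fun=> (p ^+ 2)%:E)); last first.
    by move=> j ji; rewrite integral_event ?PAI 1?eq_sym//; exact: measurableI.
  rewrite setIid integral_event// PA sumEFin sumr_const -EFinD.
  by rewrite cardC1 card_ord -[_ ^+ 2 *+ _]mulr_natl -subn1 natrB//
    (leq_ltn_trans _ (ltn_ord i)).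
rewrite sumEFin sumr_const card_ord -[(p + _) *+ _]mulr_natl; congr EFin; ring.
Qed.

(** Both sides are rearranged so that only nonnegative functions are
integrated: the cross term of the square moves to the side of g. *)
Lemma expectation_le_sqdev (g : T -> R) (b c : R) :
  measurable_fun setT g -> (forall w, 0 <= g w) -> 0 <= b -> 0 <= c ->
  0 <= p ->
  (forall w, g w <= c + b * (nb_events w - n%:R * p) ^+ 2) ->
  ('E_P[g] <= (c + b * (n%:R * p * (1 - p)))%:E)%E.
Proof.
move=> mg g0 b0 c0 p0 gle.
have mS := measurable_nb_events; have S0 := nb_events_ge0.
have np0 : 0 <= n%:R * p by rewrite mulr_ge0.
pose l := 2 * b * (n%:R * p); have l0 : 0 <= l by rewrite !mulr_ge0.
pose c' := c + b * (n%:R * p) ^+ 2.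
have c'0 : 0 <= c' by rewrite addr_ge0// mulr_ge0// sqr_ge0.
have : (\int[P]_w ((g w)%:E + l%:E * (nb_events w)%:E)
        <= \int[P]_w (c'%:E + b%:E * (nb_events w ^+ 2)%:E))%E.
  apply: ge0_le_integral => //.
  - by move=> w _; rewrite -EFinM -EFinD lee_fin addr_ge0 ?mulr_ge0.
  - apply/measurable_EFinP; apply: measurable_funD => //.
    by apply: measurable_funM.
  - apply/measurable_EFinP; apply: measurable_funD => //.
    by apply: measurable_funM => //; exact: measurable_funX.
  - move=> w _; rewrite -!EFinM -!EFinD lee_fin.
    by have := gle w; rewrite /c' /l; nra.
rewrite ge0_integralD//; last 4 first.
- by move=> w _; rewrite lee_fin.
- exact/measurable_EFinP.
- by move=> w _; rewrite -EFinM lee_fin mulr_ge0.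
- by apply/measurable_EFinP; exact: measurable_funM.
rewrite ge0_integralZl_EFin//; last 2 first.
- by move=> w _; rewrite lee_fin.
- exact/measurable_EFinP.
rewrite ge0_integralD//; last 2 first.
- by move=> w _; rewrite -EFinM lee_fin mulr_ge0// sqr_ge0.
- apply/measurable_EFinP; apply: measurable_funM => //.
  exact: measurable_funX.
rewrite ge0_integralZl_EFin//; last 2 first.
- by move=> w _; rewrite lee_fin sqr_ge0.
- by apply/measurable_EFinP; exact: measurable_funX.
rewrite integral_cst//= probability_setT mule1.
rewrite integral_nb_events integral_nb_events2 unlock -!EFinM -EFinD.
rewrite -leeBrDr// -EFinB => /le_trans; apply.
by rewrite lee_fin /c' /l; nra.
Qed.

End count_events.

(** * Loss in terms of the number of ones *)

Section loss.
Context {R : realType}.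

(** The difference of the two sides is l^-1 (u + l v)^2. *)
Lemma sqrB_young (u v l : R) : 0 < l ->
  (u - v) ^+ 2 <= (1 + l^-1) * u ^+ 2 + (1 + l) * v ^+ 2.
Proof.
move=> l0; rewrite -subr_ge0.
have -> : (1 + l^-1) * u ^+ 2 + (1 + l) * v ^+ 2 - (u - v) ^+ 2 =
    l^-1 * (u + l * v) ^+ 2 by field; rewrite gt_eqF.
by rewrite mulr_ge0 ?sqr_ge0// invr_ge0 ltW.
Qed.

(** For 0 < t < 1 this combines [argmax_sqdist] with Young's inequality.  For
t in {0, 1} the variance vanishes, so b costs nothing and b = 1 does: either the
frequency is t and [argmax_sqdist] applies, or the number of ones misses its
mean n t, an integer, by at least 1, and the loss is at most 1.  The pointwise
form spares any appeal to null sets. *)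
Lemma sqloss_le_sqdev n (Theta : set R) (Kw : R -> R) (t l : R)
    (est : n.-tuple bool -> R) :
  (0 < n)%N -> Theta `<=` [set u | 0 <= u <= 1] ->
  (forall u, Theta u -> 0 <= Kw u) -> Theta t -> 0 < l ->
  (forall x, is_argmax Theta (fun u => weight Kw u * likelihood x u) (est x)) ->
  exists b, [/\ 0 <= b,
    b * (n%:R * t * (1 - t)) <=
      ((1 + l^-1) / 2 + (1 + l) * (t * (1 - t))) / n%:R &
    forall x, (t - est x) ^+ 2 <=
      (1 + l^-1) / 2 * (ln 2 * Kw t / n%:R)
      + b * ((ones x)%:R - n%:R * t) ^+ 2].
Proof.
move=> n0 Theta01 Kw0 Tt l0 est_max.
have nR0 : 0 < n%:R :> R by rewrite ltr0n.
have l1 : 0 <= 1 + l^-1 by rewrite addr_ge0// invr_ge0 ltW.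
have t01 := Theta01 t Tt; have /andP[t0 t1] := t01.
have dev (x : n.-tuple bool) : (ones x)%:R - n%:R * t = n%:R * (freq x - t).
  by rewrite /freq; field; rewrite gt_eqF.
have key x : dominated (freq x) t -> (t - est x) ^+ 2 <=
    (1 + l^-1) / 2 * (ln 2 * Kw t / n%:R + (freq x - t) ^+ 2 / (t * (1 - t)))
    + (1 + l) * (freq x - t) ^+ 2.
  move=> dom; have [Te _] := est_max x.
  have argm := argmax_sqdist n0 Theta01 (Kw0 _ Te) (est_max x) Tt dom.
  rewrite (_ : t - est x = (freq x - est x) - (freq x - t)); last by ring.
  apply: (le_trans (sqrB_young _ _ l0)); rewrite lerD2r -mulrA.
  by rewrite ler_wpM2l// ler_pdivlMl.
have c0 : 0 <= (1 + l^-1) / 2 * (ln 2 * Kw t / n%:R).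
  by rewrite !mulr_ge0 ?Kw0 ?invr_ge0 ?ln_ge0 ?ler1n.
have [V0|Vn0] := eqVneq (t * (1 - t)) 0.
  exists 1; split=> //.
    by rewrite mul1r -mulrA V0 !mulr0 addr0 !mulr_ge0// invr_ge0 ltW.
  move=> x; have [ft|ft] := eqVneq (freq x) t.
    rewrite dev ft subrr mulr0 expr0n mulr0 addr0.
    have := key x; rewrite ft subrr expr0n mul0r mulr0 !addr0.
    by apply; split=> ->.
  have [m nt] : exists m, n%:R * t = m%:R :> R.
    move/eqP: V0; rewrite mulf_eq0 subr_eq0 => /orP[/eqP ->|/eqP <-].
      by exists 0%N; rewrite mulr0.
    by exists n; rewrite mulr1.
  have dev1 : 1 <= ((ones x)%:R - n%:R * t) ^+ 2 :> R.
    have : (ones x)%:R - n%:R * t != 0.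
      by rewrite dev mulf_neq0 ?subr_eq0 ?(gt_eqF nR0).
    rewrite nt -[leRHS]real_normK ?num_real// subr_eq0 eqr_nat neq_ltn.
    move=> neq; apply: exprn_ege1; case/orP: neq => mk.
      rewrite distrC ger0_norm ?subr_ge0 ?ler_nat 1?ltnW//.
      by rewrite lerBrDl natr1 ler_nat.
    rewrite ger0_norm ?subr_ge0 ?ler_nat 1?ltnW//.
    by rewrite lerBrDl natr1 ler_nat.
  have [/Theta01/andP[e0 e1] _] := est_max x.
  rewrite mul1r (le_trans _ (lerD c0 dev1))// add0r.
  by nra.
have V0 : 0 < t * (1 - t) by rewrite lt0r Vn0/= mulr_ge0// subr_ge0.
have /andP[tn0 tn1] : (t != 0) && (1 - t != 0) by rewrite -negb_or -mulf_eq0.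
pose b := ((1 + l^-1) / 2 / (t * (1 - t)) + (1 + l)) / n%:R ^+ 2.
exists b; split.
- by rewrite /b divr_ge0 ?exprn_ge0// addr_ge0 ?addr_ge0 ?divr_ge0// ltW.
- rewrite le_eqVlt; apply/orP; left; apply/eqP; rewrite /b.
  by field; rewrite tn0 tn1 !gt_eqF.
- move=> x; have dom : dominated (freq x) t.
    by split=> tE; move: Vn0; rewrite tE ?subrr ?mul0r ?mulr0 eqxx.
  apply: (le_trans (key x dom)); rewrite dev.
  rewrite le_eqVlt; apply/orP; left; apply/eqP.
  by rewrite /b; field; rewrite tn0 tn1 !gt_eqF.
Qed.

(** From ln (1/3) <= 1/3 - 1. *)
Lemma ln_nat_ge n : (3 <= n)%N -> 2 / 3 <= ln n%:R :> R.
Proof.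
move=> n3; have n0 : (0 < n)%N by exact: leq_trans n3.
have n3R : 3 <= n%:R :> R by rewrite ler_nat.
have ln3 : ln 3^-1 <= 3^-1 - 1 :> R.
  by rewrite -{1}[3^-1](subrKC 1) le_ln1Dx//; lra.
rewrite lnV ?posrE// in ln3.
have : ln 3 <= ln n%:R :> R by rewrite ler_ln ?posrE// ltr0n.
by lra.
Qed.

(** With s = sqrt (2 L), so that L = s^2 / 2, the value l = 1 + s gives
(L + 1) / l <= 1 + s; it is linear in s and within a constant
of sqrt (2 (L + 1)), the optimal value for V = 1/4.  Times N, the left side is then at most
L / 2 + 3 s / 4 + 3 / 2, and 3/4 <= sqrt a, 3/2 <= 6 a. *)
Lemma mdl_bound_arith (L V N a l : R) : l = 1 + Num.sqrt (2 * L) ->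
  0 <= L -> V <= 4^-1 -> 0 < N -> 2 / 3 <= a ->
  (1 + l^-1) / 2 * (L / N) + ((1 + l^-1) / 2 + (1 + l) * V) / N <=
  L / (2 * N) + Num.sqrt (2 * L * a) / N + 6 * a / N.
Proof.
move=> lE L0 V4 N0 a23; have L20 : 0 <= 2 * L by rewrite mulr_ge0.
rewrite (sqrtrM a L20); set s := Num.sqrt (2 * L) in lE *.
have s0 : 0 <= s by exact: sqrtr_ge0.
have sE : s ^+ 2 = 2 * L by exact: sqr_sqrtr.
have l0 : 0 < l by rewrite lE ltr_wpDr.
have sa : 3 / 4 <= Num.sqrt a.
  rewrite -[leLHS]ger0_norm ?divr_ge0// -sqrtr_sqr ler_sqrt; lra.
rewrite -[L / (2 * N)](_ : L / 2 / N = _); last by field; rewrite gt_eqF.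
rewrite mulrA -!mulrDl ler_pM2r ?invr_gt0//.
have ls : l^-1 * (L + 1) <= 1 + s.
  by rewrite ler_pdivrMl// lE; nra.
have lV : (1 + l) * V <= (1 + l) * 4^-1 by rewrite ler_pM2l ?addr_gt0.
have ssa : s * (3 / 4) <= s * Num.sqrt a by rewrite ler_wpM2l.
by lra.
Qed.

End loss.

(** * Independent bits *)

Section bits.
Context {d : measure_display} {T : measurableType d} {R : realType}.
Variable P : probability T R.
Variables (n : nat) (X : 'I_n -> {RV P >-> bool}).

(** Any function of finitely many bits is measurable: a preimage is the finite
union of the cylinders of the bit strings it contains. *)
Lemma measurable_bits d' (T' : measurableType d') (h : n.-tuple bool -> T') :
  measurable_fun setT (fun w => h [tuple X i w | i < n]).
Proof.
move=> _ B _; rewrite setTI.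
rewrite (_ : _ @^-1` _ = \bigcup_(x in [set x | B (h x)])
    \bigcap_(i in [set: 'I_n]) (X i @^-1` [set tnth x i])); last first.
  apply/seteqP; split=> w /= => [Bw|[x Bx] Xx].
    by exists [tuple X i w | i < n] => // i _ /=; rewrite tnth_mktuple.
  rewrite (_ : [tuple X i w | i < n] = x)//.
  by apply: eq_from_tnth => i; rewrite tnth_mktuple Xx.
apply: fin_bigcup_measurable => [|x _]; first exact: finite_finset.
apply: fin_bigcap_measurable => [|i _]; first exact: finite_finset.
by rewrite -[X in measurable X]setTI; exact: measurable_funPT.
Qed.

Lemma ones_bits w :
  (ones [tuple X i w | i < n])%:R
  = nb_events (fun i => X i @^-1` [set true]) w :> R.
Proof.
rewrite /ones /nb_events -sum1_count big_mkcond big_tuple natr_sum.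
apply: eq_bigr => i _; rewrite tnth_mktuple indicE /=.
by case E: (X i w); [rewrite mem_set|rewrite memNset//= E].
Qed.

Lemma iid_bits_pair (p : R) i j : iid_bits p X -> i != j ->
  P (X i @^-1` [set true] `&` X j @^-1` [set true]) = (p ^+ 2)%:E.
Proof.
move=> [indep PX] ij.
have := indep [set i; j]%SET (fun=> [set true]) (fun=> ltac:(by [])).
rewrite big_setU1 ?inE//= big_set1 !PX -EFinM -expr2 => <-.
congr (P _); apply/seteqP; split=> w /=.
  by move=> [wi wj] k /=; rewrite !inE => /orP[] /eqP ->.
by move=> w_ij; split; apply: w_ij; rewrite /= !inE eqxx ?orbT.
Qed.

End bits.

(** * Expected loss *)

Theorem proposition7 (R : realType) (Theta : set R) (Kw : R -> R) (theta0 : R)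
  (n : nat) (est : n.-tuple bool -> R)
  (d : measure_display) (T : measurableType d) (P : probability T R)
  (X : 'I_n -> {RV P >-> bool})
  (Theta01 : Theta `<=` [set t | 0 <= t <= 1])
  (Theta_countable : countable Theta)
  (Kw_ge0 : forall t, Theta t -> 0 <= Kw t)
  (Theta_theta0 : Theta theta0)
  (n_ge3 : (3 <= n)%N)
  (est_mdl : mdl_estimator Theta Kw est)
  (X_iid : iid_bits theta0 X) :
  ('E_P[ fun w => ((theta0 - est [tuple X i w | i < n]) ^+ 2)%R ] <=
   (ln 2 * Kw theta0 / (2 * n%:R)
    + Num.sqrt (2 * ln 2 * Kw theta0 * ln n%:R) / n%:R
    + 6 * ln n%:R / n%:R)%:E)%E.
Proof.
have n0 : (0 < n)%N by exact: leq_trans n_ge3.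
have nR0 : 0 < n%:R :> R by rewrite ltr0n.
have /andP[t0 t1] := Theta01 _ Theta_theta0.
have L0 : 0 <= ln 2 * Kw theta0 by rewrite mulr_ge0 ?Kw_ge0 ?ln_ge0 ?ler1n.
pose l := 1 + Num.sqrt (2 * (ln 2 * Kw theta0)).
have l0 : 0 < l by rewrite ltr_wpDr ?sqrtr_ge0.
have [b [b0 bV est_le]] :=
  sqloss_le_sqdev n0 Theta01 Kw_ge0 Theta_theta0 l0 est_mdl.1.
have mA i : measurable (X i @^-1` [set true]).
  by rewrite -[X in measurable X]setTI; exact: measurable_funPT.
have c0 : 0 <= (1 + l^-1) / 2 * (ln 2 * Kw theta0 / n%:R).
  by rewrite mulr_ge0 ?divr_ge0 ?addr_ge0 ?invr_ge0 ?(ltW l0) ?(ltW nR0).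
apply: (@le_trans _ _ (((1 + l^-1) / 2 * (ln 2 * Kw theta0 / n%:R)
    + b * (n%:R * theta0 * (1 - theta0)))%:E)).
  apply: (expectation_le_sqdev mA X_iid.2 _ _ _ b0 c0 t0).
  - by move=> i j ij; exact: iid_bits_pair X_iid ij.
  - exact: (measurable_bits X (fun x => (theta0 - est x) ^+ 2)).
  - by move=> w; exact: sqr_ge0.
  - by move=> w; rewrite -ones_bits; exact: est_le.
rewrite lee_fin (le_trans (lerD (lexx _) bV))// -(mulrA 2 (ln 2)).
apply: mdl_bound_arith => //; [|exact: ln_nat_ge].
by have := sqr_ge0 (theta0 - 2^-1); nra.
Qed.
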